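(* There exists an open dense subset $\Omega$ of $(\mathbb{C}^{d\times d})^3$ such that for all triplets $(c_{-1},c_0,c_1)\in\Omega$ and for all $\mathbf{g}:[t_0,t_f]\to\mathbb{C}^d$, there exists one and only one extension $\mathbf{f}:\mathbb{R}\to\mathbb{C}^d$ of $\mathbf{g}$ to $\mathbb{R}$ such that $\mathrm{Supp}(\mathbf{f})\subset[t_0-\varepsilon,t_f+\varepsilon]$ and the functional equation $\mathbf{f}=\Box\mathbf{u}$ admits one and only one solution $\mathbf{u}$ in $[t_0,t_f]$.
   Context: Here $d\ge1$, $[t_0,t_f]\subset\mathbb{R}$ is a fixed segment with characteristic function $\chi$, and $\varepsilon>0$ is a fixed time delay; it is assumed that the integer part $M$ of $\frac{t_f-t_0}{\varepsilon}$ satisfies $M\ge1$. For $c_{-1},c_0,c_1\in\mathbb{C}^{d\times d}$ and $\mathbf{u}:\mathbb{R}\to\mathbb{C}^d$, $$\Box\mathbf{u}(t)=\sum_{k=-1}^{1}c_k\,\mathbf{u}(t+k\varepsilon)\,\chi(t+k\varepsilon),\qquad t\in\mathbb{R}.$$ Since $\Box\mathbf{u}$ depends only on the restriction of $\mathbf{u}$ to $[t_0,t_f]$, ''one and only one solution in $[t_0,t_f]$'' means that there is exactly one function $[t_0,t_f]\to\mathbb{C}^d$ which is the restriction to $[t_0,t_f]$ of some $\mathbf{u}:\mathbb{R}\to\mathbb{C}^d$ with $\Box\mathbf{u}=\mathbf{f}$ on $\mathbb{R}$. No regularity is assumed on the functions. *)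

(* Defs.v *)
From HB Require Import structures.
From mathcomp Require Import all_boot all_order all_algebra.
From mathcomp Require Import all_classical all_reals all_analysis.
From mathcomp Require Import complex.

Set Implicit Arguments.
Unset Strict Implicit.
Unset Printing Implicit Defensive.

Import Order.TTheory GRing.Theory Num.Theory.
Import numFieldNormedType.Exports.

Local Open Scope classical_set_scope.
Local Open Scope ring_scope.
Local Open Scope complex_scope.

(* The norm topology of C; real-closed gives R[i] no topology of its own. *)
HB.instance Definition _ (R : realType) := NormedModule.copy R[i] R[i]^o.

(* c is the triplet (c_{-1}, c_0, c_1). *)
Definition box (R : realType) (d : nat) (t0 tf eps : R)
    (c : 'M[R[i]]_d * 'M[R[i]]_d * 'M[R[i]]_d) (u : R -> 'cV[R[i]]_d) (t : R)
    : 'cV[R[i]]_d :=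
  let: (cm1, c0, c1) := c in
  let chi : R -> R[i] := \1_(`[t0, tf]%classic) in
    chi (t - eps) *: (cm1 *m u (t - eps))
  + chi t *: (c0 *m u t)
  + chi (t + eps) *: (c1 *m u (t + eps)).

Definition supp (R : realType) (d : nat) (f : R -> 'cV[R[i]]_d) : set R :=
  closure [set t | f t != 0].

(* box ignores the values of u outside [t0, tf], so uniqueness is only
   meaningful for the restriction w, a function on the subtype. *)
Definition solution_on (R : realType) (d : nat) (t0 tf eps : R)
    (c : 'M[R[i]]_d * 'M[R[i]]_d * 'M[R[i]]_d) (f : R -> 'cV[R[i]]_d)
    (w : `[t0, tf]%classic -> 'cV[R[i]]_d) : Prop :=
  exists u : R -> 'cV[R[i]]_d,
    (forall t : `[t0, tf]%classic, u (val t) = w t) /\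
    (forall t : R, box t0 tf eps c u t = f t).

(* Main.v *)
Require Import Defs.
From HB Require Import structures.
From mathcomp Require Import all_boot all_order all_algebra.
From mathcomp Require Import all_classical all_reals all_analysis.
From mathcomp Require Import complex.
From mathcomp Require Import zify lra.

Set Implicit Arguments.
Unset Strict Implicit.
Unset Printing Implicit Defensive.

Import Order.TTheory GRing.Theory Num.Theory.
Import numFieldNormedType.Exports.

Local Open Scope classical_set_scope.
Local Open Scope ring_scope.
Local Open Scope complex_scope.

(* A solution is sought separately on each class of [t0, tf] modulo eps.  On the
   class of s, with n points s, s + eps, ..., s + (n - 1) eps in [t0, tf], the
   equation box u = g is a linear system whose matrix is the block tridiagonal
   Toeplitz matrix with n x n blocks built on (c_{-1}, c_0, c_1), and n takes
   finitely many values.  Where all the corresponding determinants are nonzero,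
   g determines u on [t0, tf], and then f = box u is the only possible extension.
   This set is open since determinants are continuous; it is dense since along
   the line c_0 + z Id each determinant is a monic polynomial in z (a
   characteristic polynomial), hence has finitely many zeros. *)

(** * The block Toeplitz operator and its determinants *)

(** Multiplication on the right by this matrix moves each column one place to the right and puts 0
    in the first one; the transpose moves columns to the left and puts 0 in the last one. These
    zeros play the role of the cutoff by [chi]. *)
Definition shift_mx (K : nzRingType) n : 'M[K]_n :=
  \matrix_(j, k) (j.+1 == k :> nat)%:R.

(* The columns of U are the values of the unknown along a class modulo eps. *)
Definition block_toeplitz (K : comNzRingType) d n (c : 'M[K]_d * 'M[K]_d * 'M[K]_d)
    (U : 'M[K]_(d, n)) : 'M[K]_(d, n) :=
  c.1.1 *m (U *m shift_mx K n) + c.1.2 *m U + c.2 *m (U *m (shift_mx K n)^T).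

Lemma block_toeplitz_is_linear (K : comNzRingType) d n
    (c : 'M[K]_d * 'M[K]_d * 'M[K]_d) : linear (@block_toeplitz K d n c).
Proof.
move=> a U V; rewrite /block_toeplitz !mulmxDl !mulmxDr -!scalemxAl -!scalemxAr.
by rewrite !scalerDr [RHS]addrACA; congr (_ + _); rewrite addrACA.
Qed.

HB.instance Definition _ (K : comNzRingType) d n (c : 'M[K]_d * 'M[K]_d * 'M[K]_d) :=
  GRing.isLinear.Build K _ _ _ (@block_toeplitz K d n c) (block_toeplitz_is_linear c).

(** The sequence [u] is indexed by [int] so that [k - 1] makes sense at [k = 0]; the Boolean factors
    express the zero columns created by the shifts. *)
Lemma col_block_toeplitz (K : comNzRingType) d n (c : 'M[K]_d * 'M[K]_d * 'M[K]_d)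
    (u : int -> 'cV[K]_d) (k : 'I_n) :
  col k (block_toeplitz c (\matrix_(i < d, j < n) u j i 0)) =
    (0 < k)%N%:R *: (c.1.1 *m u (k%:Z - 1)) + c.1.2 *m u k
      + (k.+1 < n)%N%:R *: (c.2 *m u (k%:Z + 1)).
Proof.
rewrite /block_toeplitz colE !mulmxDl.
rewrite -(mulmxA c.1.1) -(mulmxA c.1.2) -(mulmxA c.2) -!colE.
congr (_ + _ + _).
- rewrite scalemxAr; congr (_ *m _); apply/matrixP => i j; rewrite ord1 !mxE.
  case: k => -[|k] lt_k /=.
    by rewrite mul0r big1// => l _; rewrite !mxE/= mulr0.
  rewrite (bigD1 (Ordinal (ltnW lt_k)))//= !mxE/= eqxx mulr1 mul1r big1 ?addr0.
    by rewrite intS addrC addKr.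
  by move=> l; rewrite -val_eqE/= => /negbTE l_k; rewrite !mxE/= eqSS l_k mulr0.
- by congr (_ *m _); apply/matrixP => i j; rewrite ord1 !mxE.
- rewrite scalemxAr; congr (_ *m _); apply/matrixP => i j; rewrite ord1 !mxE.
  have [lt_k|le_n] := ltnP k.+1 n.
    rewrite (bigD1 (Ordinal lt_k))//= !mxE/= eqxx mulr1 mul1r big1 ?addr0.
      by rewrite intS addrC.
    move=> l; rewrite -val_eqE/= => /negbTE l_k.
    by rewrite !mxE/= eq_sym l_k mulr0.
  rewrite mul0r big1// => l _; rewrite !mxE/= (_ : _ == _ = false) ?mulr0//.
  by apply/negbTE; rewrite gtn_eqF// (leq_trans (ltn_ord l)).
Qed.

Definition toeplitz_mx (K : comNzRingType) d n (c : 'M[K]_d * 'M[K]_d * 'M[K]_d) :=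
  lin_mx (@block_toeplitz K d n c).

(** Taking the product over all sizes below [N] turns finitely many nonvanishing conditions into
    one. *)
Definition toeplitz_dets (K : comNzRingType) d N (c : 'M[K]_d * 'M[K]_d * 'M[K]_d) :=
  \prod_(n < N) \det (toeplitz_mx n c).

Lemma block_toeplitz_bij (K : fieldType) d n (c : 'M[K]_d * 'M[K]_d * 'M[K]_d) :
  \det (toeplitz_mx n c) != 0 -> bijective (@block_toeplitz K d n c).
Proof.
rewrite -unitfE -/(_ \in unitmx) => uT.
exists (fun V => vec_mx (mxvec V *m invmx (toeplitz_mx n c))) => V.
  by rewrite -mul_vec_lin mulmxK// mxvecK.
by apply: (can_inj mxvecK); rewrite -mul_vec_lin vec_mxK mulmxKV.
Qed.

(** Adding [z] to the central coefficient adds [z *: U] to the image of [U], hence a scalar matrix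
    to the matrix of the operator. *)
Lemma toeplitz_mxD (K : comNzRingType) d n (c : 'M[K]_d * 'M[K]_d * 'M[K]_d) z :
  toeplitz_mx n (c.1.1, z%:M + c.1.2, c.2) = z%:M + toeplitz_mx n c.
Proof.
apply/row_matrixP => i; rewrite linearD /= !rowE mul_mx_scalar.
case/mxvec_indexP: i => i j.
rewrite -mxvec_delta !mul_vec_lin -linearZ -linearD /=; congr mxvec.
by rewrite /block_toeplitz /= mulmxDl mul_scalar_mx addrCA -!addrA addrCA.
Qed.

Lemma toeplitz_dets_poly (K : comNzRingType) d N (c : 'M[K]_d * 'M[K]_d * 'M[K]_d) :
  exists2 p : {poly K}, p \is monic &
    forall z, p.[z] = toeplitz_dets N (c.1.1, z%:M + c.1.2, c.2).
Proof.
(* The sign comes from [\det (z + T)] being the characteristic polynomial of [- T] at [z]. *)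
exists (\prod_(n < N) char_poly (- toeplitz_mx n c)).
  by apply: monic_prod => n _; exact: char_poly_monic.
move=> z; rewrite horner_prod; apply: eq_bigr => n _.
rewrite toeplitz_mxD /char_poly -horner_evalE -det_map_mx; congr (\det _).
apply/matrixP => i j; rewrite !mxE /= /horner_eval hornerD hornerN hornerMn.
by rewrite hornerX hornerC opprK.
Qed.

(** * Continuity of the determinants in the triplet *)

Lemma continuous_prod (K : numFieldType) (T : topologicalType) (I : Type) (r : seq I)
    (F : I -> T -> K) :
  (forall i, continuous (F i)) -> continuous (fun x => \prod_(i <- r) F i x).
Proof. by move=> cF; apply: continuous_big => //; exact: mul_continuous. Qed.

Lemma continuous_sum (K : numFieldType) (T : topologicalType) (I : Type) (r : seq I)
    (F : I -> T -> K) :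
  (forall i, continuous (F i)) -> continuous (fun x => \sum_(i <- r) F i x).
Proof. by move=> cF; apply: continuous_big => //; exact: add_continuous. Qed.

Lemma continuous_det (K : numFieldType) (T : topologicalType) n (A : T -> 'M[K]_n) :
  (forall i j, continuous (fun x => A x i j)) -> continuous (fun x => \det (A x)).
Proof.
move=> cA; apply: continuous_sum => s x; apply: cvgM; first exact: cvg_cst.
by apply: continuous_prod => i; exact: cA.
Qed.

Lemma continuous_mulmxl_coord (K : numFieldType) (T : topologicalType) m n p
    (A : T -> 'M[K]_(m, n)) (V : 'M[K]_(n, p)) i j :
  continuous A -> continuous (fun x => (A x *m V) i j).
Proof.
move=> cA; rewrite (_ : (fun x => _) = fun x => \sum_k A x i k * V k j).
  apply: continuous_sum => k x; apply: cvgM; last exact: cvg_cst.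
  exact: (continuous_comp (cA x) (@coord_continuous _ _ _ i k _)).
by apply/funext => x; rewrite mxE.
Qed.

Lemma toeplitz_mxE (K : comNzRingType) d n (c : 'M[K]_d * 'M[K]_d * 'M[K]_d)
    i i' j j' :
  toeplitz_mx n c (mxvec_index i i') (mxvec_index j j') =
    block_toeplitz c (delta_mx i i') j j'.
Proof.
transitivity (row (mxvec_index i i') (toeplitz_mx n c) 0 (mxvec_index j j')).
  by rewrite [RHS]mxE.
by rewrite rowE -mxvec_delta mul_vec_lin mxvecE.
Qed.

Lemma continuous_toeplitz_dets (K : numFieldType) d N :
  continuous (@toeplitz_dets K d N).
Proof.
apply: continuous_prod => n; apply: continuous_det => i j.
case/mxvec_indexP: i => i i'; case/mxvec_indexP: j => j j'.
set D := delta_mx i i' : 'M[K]_(d, n).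
(* Each entry of the matrix is a linear form in the coefficients of the triplet. *)
rewrite (_ : (fun c => _) = fun c : 'M[K]_d * 'M[K]_d * 'M[K]_d =>
    (c.1.1 *m (D *m shift_mx K n)) j j' + (c.1.2 *m D) j j'
      + (c.2 *m (D *m (shift_mx K n)^T)) j j'); last first.
  apply/funext => c; rewrite toeplitz_mxE [LHS]mxE; congr (_ + _).
  by rewrite [LHS]mxE.
move=> c; apply: cvgD; first apply: cvgD.
- apply: (continuous_mulmxl_coord (A := fun c => c.1.1)) => {}c.
  by apply: (continuous_comp (f := fst) (g := fst)); exact: cvg_fst.
- apply: (continuous_mulmxl_coord (A := fun c => c.1.2)) => {}c.
  by apply: (continuous_comp (f := fst) (g := snd)); [exact: cvg_fst|exact: cvg_snd].
- by apply: (continuous_mulmxl_coord (A := snd)) => {}c; exact: cvg_snd.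
Qed.

(** * Openness and density of the generic set *)

(** Pigeonhole: [size p] distinct points of the ball cannot all be roots of [p]. *)
Lemma poly_neq0_ball (K : numFieldType) (p : {poly K}) (e : K) :
  p != 0 -> 0 < e -> exists2 z, `|z| < e & p.[z] != 0.
Proof.
(* The denominators start at 2 so that every point has norm strictly below [e]. *)
move=> p0 e0; pose f k : K := e / k.+2%:R.
have f_inj : injective f.
  move=> j k /(mulfI (lt0r_neq0 e0)) /invr_inj /eqP.
  by rewrite eqr_nat => /eqP [].
have [/allP/= all_root|] := boolP (all (root p) (map f (iota 0 (size p)))).
  have := max_poly_roots p0 (introT allP all_root).
  by rewrite map_inj_uniq// iota_uniq size_map size_iota ltnn => /(_ isT).
case/allPn => _ /mapP [k _ ->] nroot; exists (f k) => //.
by rewrite gtr0_norm ?divr_gt0// ltr_pdivrMr// ltr_pMr// ltr1n.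
Qed.

Definition toeplitz_generic (K : numFieldType) d N : set ('M[K]_d * 'M[K]_d * 'M[K]_d) :=
  [set c | toeplitz_dets N c != 0].

Lemma open_toeplitz_generic (K : numFieldType) d N : open (@toeplitz_generic K d N).
Proof.
apply: (@open_comp _ _ _ [set x : K | x != 0]).
  by move=> c _; exact: continuous_toeplitz_dets.
rewrite (_ : [set x | _] = ~` [set 0]); last by apply/seteqP; split=> x /eqP.
exact/closed_openC/accessible_closed_set1/hausdorff_accessible/norm_hausdorff.
Qed.

(** A neighbourhood of a matrix contains a product of neighbourhoods of its finitely many
    entries. *)
Lemma continuous_mx (T U : topologicalType) m n (A : T -> 'M[U]_(m, n)) (x : T) :
  (forall i j, {for x, continuous (fun y => A y i j)}) -> {for x, continuous A}.
Proof.
move=> cA S [P AP subP].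
apply: (@filterS _ (nbhs x) _ (fun y => forall i j, P i j (A y i j))).
  by move=> y; exact: subP.
by apply: filter_forall => i; apply: filter_forall => j; exact: cA.
Qed.

Lemma continuous_pair (T U V : topologicalType) (f : T -> U) (g : T -> V) (x : T) :
  {for x, continuous f} -> {for x, continuous g} ->
  {for x, continuous (fun y => (f y, g y))}.
Proof. by move=> cf cg; exact: cvg_pair. Qed.

Lemma continuous_affine (K : numFieldType) (T : topologicalType) (f : T -> K) (a b : K) :
  continuous f -> continuous (fun x => f x * a + b).
Proof.
move=> cf x; apply: cvgD; last exact: cvg_cst.
by apply: cvgM; [exact: cf|exact: cvg_cst].
Qed.

Lemma dense_toeplitz_generic (K : numFieldType) d N : dense (@toeplitz_generic K d N).
Proof.
move=> O [c Oc] openO.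
pose F (z : K) : 'M[K]_d * 'M[K]_d * 'M[K]_d := (c.1.1, z%:M + c.1.2, c.2).
have F0 : F 0 = c by rewrite /F raddf0 add0r; case: (c) => [[]].
have cF : F z @[z --> 0] --> F 0.
  apply: (continuous_pair (f := fun z => (c.1.1, z%:M + c.1.2)) (g := fun=> c.2));
    last exact: cst_continuous.
  apply: (continuous_pair (f := fun=> c.1.1)); first exact: cst_continuous.
  apply: continuous_mx => i j.
  rewrite (_ : (fun z => _) = fun z : K => z * (i == j)%:R + c.1.2 i j); last first.
    by apply/funext => z; rewrite !mxE mulr_natr.
  by apply: (continuous_affine (f := id)) => ?; exact: cvg_id.
(* The line [F] stays in [O] for small [z], and only finitely many [z] are roots. *)
have : nbhs 0 (F @^-1` O) by apply: cF; rewrite F0; exact: open_nbhs_nbhs.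
case/nbhs_ballP => e /= e0 ballO.
have [p p_monic pE] := toeplitz_dets_poly N c.
have [z z_lt pz] := poly_neq0_ball (monic_neq0 p_monic) e0.
exists (F z); split; last by rewrite /toeplitz_generic /= -pE.
by apply: ballO; rewrite -ball_normE /= sub0r normrN.
Qed.

(** * Reduction of [box] to block Toeplitz systems *)

(** The solution is a sequence, whose type does not depend on [n], so that one choice function can
    serve classes of different sizes. *)
Lemma block_toeplitz_solve (K : fieldType) d n (c : 'M[K]_d * 'M[K]_d * 'M[K]_d)
    (g : nat -> 'cV[K]_d) :
  \det (toeplitz_mx n c) != 0 ->
  exists v : nat -> 'cV[K]_d,
    forall k : 'I_n, col k (block_toeplitz c (\matrix_(i < d, j < n) v j i 0)) = g k.
Proof.
move=> /block_toeplitz_bij [h _ hK].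
pose U := h (\matrix_(i < d, j < n) g j i 0).
(* The sum has at most one term: it is column [j] of [U], or 0 when [j >= n]. *)
exists (fun j => \sum_(l < n | l == j :> nat) col l U) => k.
rewrite (_ : \matrix_(_, _) _ = U).
  by rewrite hK; apply/matrixP => i j; rewrite ord1 !mxE.
apply/matrixP => i j; rewrite !mxE (big_pred1 j) ?mxE //.
Qed.

Lemma boxE (R : realType) d (t0 tf eps : R) (c : 'M[R[i]]_d * 'M[R[i]]_d * 'M[R[i]]_d)
    (u : R -> 'cV[R[i]]_d) t :
  box t0 tf eps c u t =
    (t - eps \in `[t0, tf])%:R *: (c.1.1 *m u (t - eps))
    + (t \in `[t0, tf])%:R *: (c.1.2 *m u t)
    + (t + eps \in `[t0, tf])%:R *: (c.2 *m u (t + eps)).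
Proof.
case: c => [[cm1 c0] c1] /=; by rewrite /box !indicE !mem_setE.
Qed.

Lemma eq_box (R : realType) d (t0 tf eps : R) (c : 'M[R[i]]_d * 'M[R[i]]_d * 'M[R[i]]_d)
    (u v : R -> 'cV[R[i]]_d) :
  {in `[t0, tf], u =1 v} -> box t0 tf eps c u = box t0 tf eps c v.
Proof.
move=> uv; apply/funext => t; rewrite !boxE.
have chi_uv (a : 'M[R[i]]_d) s :
    (s \in `[t0, tf])%:R *: (a *m u s) = (s \in `[t0, tf])%:R *: (a *m v s).
  by have [/uv ->|_] := boolP (s \in `[t0, tf]); rewrite ?scale0r.
by rewrite !chi_uv.
Qed.

(** For [t] outside the larger segment, [t - eps], [t] and [t + eps] all miss [[t0, tf]]; that
    segment being closed, the closure adds nothing outside it. *)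
Lemma supp_box (R : realType) d (t0 tf eps : R) (c : 'M[R[i]]_d * 'M[R[i]]_d * 'M[R[i]]_d)
    (u : R -> 'cV[R[i]]_d) :
  0 <= eps -> supp (box t0 tf eps c u) `<=` `[t0 - eps, tf + eps].
Proof.
move=> eps0; have /closure_id -> : closed `[t0 - eps, tf + eps] by exact: itv_closed.
apply: closureS => t /=; apply: contraNT; rewrite in_itv/= => t_out.
have out x : x \in `[t0, tf] -> `|t - x| <= eps -> False.
  rewrite in_itv/= ler_distl => /andP[? ?] /andP[? ?].
  by case/negP: t_out; apply/andP; split; lra.
rewrite boxE.
have -> : (t - eps \in `[t0, tf]) = false.
  by apply/negP => /out; apply; rewrite opprB addrC subrK ger0_norm.
have -> : (t \in `[t0, tf]) = false.
  by apply/negP => /out; apply; rewrite subrr normr0.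
have -> : (t + eps \in `[t0, tf]) = false.
  by apply/negP => /out; apply; rewrite opprD addNKr normrN ger0_norm.
by rewrite !scale0r !addr0.
Qed.

(** By hypothesis the class of [s] meets the segment exactly at the indices [0, ..., n - 1], so the
    values of [chi] are the Boolean factors of [col_block_toeplitz]. *)
Lemma box_grid (R : realType) d n (t0 tf eps s : R)
    (c : 'M[R[i]]_d * 'M[R[i]]_d * 'M[R[i]]_d) (u : R -> 'cV[R[i]]_d) :
  (forall k : int, (s + k%:~R * eps \in `[t0, tf]) = (0 <= k < n%:Z)) ->
  forall k : 'I_n, box t0 tf eps c u (s + k%:~R * eps) =
    col k (block_toeplitz c (\matrix_(i < d, j < n) u (s + j%:~R * eps) i 0)).
Proof.
move=> grid k.
rewrite (col_block_toeplitz c (fun k : int => u (s + k%:~R * eps))) boxE.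
have -> : s + k%:~R * eps - eps = s + (k%:Z - 1)%:~R * eps.
  by rewrite intrB mulrBl mul1r addrA.
have -> : s + k%:~R * eps + eps = s + (k%:Z + 1)%:~R * eps.
  by rewrite intrD mulrDl mul1r addrA.
rewrite !grid; congr (_%:R *: _ + _ + _%:R *: _).
- by have := ltn_ord k; lia.
- by rewrite le0z_nat ltz_nat ltn_ord scale1r.
- by lia.
Qed.

(** * Classes modulo [eps] in the segment *)

Definition grid_index (R : realType) (t0 eps t : R) : int := Num.floor ((t - t0) / eps).

(** The representative in [[t0, t0 + eps[] of the class of [t]. *)
Definition grid_base (R : realType) (t0 eps t : R) : R :=
  t - (grid_index t0 eps t)%:~R * eps.

(** For [s <= tf] the floor is nonnegative, and this counts the [k >= 0] with
    [s + k * eps <= tf]. *)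
Definition grid_size (R : realType) (tf eps s : R) : nat :=
  absz (Num.floor ((tf - s) / eps) + 1).

Lemma grid_base_itv (R : realType) (t0 eps t : R) :
  0 < eps -> grid_base t0 eps t \in `[t0, t0 + eps[.
Proof.
move=> eps0; rewrite in_itv/= /grid_base /grid_index.
have /andP[] := floor_itv ((t - t0) / eps); move: (Num.floor _) => f.
rewrite ler_pdivlMr// ltr_pdivrMr// intrD mulr1z mulrDl mul1r => *.
by apply/andP; split; lra.
Qed.

Lemma grid_indexK (R : realType) (t0 eps s : R) (k : int) :
  0 < eps -> s \in `[t0, t0 + eps[ -> grid_index t0 eps (s + k%:~R * eps) = k.
Proof.
rewrite in_itv/= => eps0 /andP[s0 s1]; apply: floor_def.
by rewrite ler_pdivlMr// ltr_pdivrMr// intrD mulr1z mulrDl mul1r; apply/andP; split; lra.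
Qed.

Lemma grid_baseK (R : realType) (t0 eps s : R) (k : int) :
  0 < eps -> s \in `[t0, t0 + eps[ -> grid_base t0 eps (s + k%:~R * eps) = s.
Proof. by move=> eps0 s_itv; rewrite /grid_base grid_indexK// addrK. Qed.

Lemma in_grid (R : realType) (t0 tf eps s : R) :
  0 < eps -> s \in `[t0, t0 + eps[ -> s <= tf -> forall k : int,
  (s + k%:~R * eps \in `[t0, tf]) = (0 <= k < (grid_size tf eps s)%:Z).
Proof.
rewrite in_itv/= => eps0 /andP[s0 s1] s_tf k; rewrite in_itv/=.
have f0 : 0 <= Num.floor ((tf - s) / eps).
  by rewrite floor_ge0 divr_ge0 ?subr_ge0// ltW.
rewrite /grid_size gez0_abs ?addr_ge0// ltzD1 floor_ge_int ler_pdivlMr//.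
rewrite -[LHS]andbC [RHS]andbC; congr andb; first by rewrite lerBrDl.
apply/idP/idP => [le_t0|k0]; last by rewrite ler_wpDr// mulr_ge0 ?ler0z// ltW.
(* Since [s < t0 + eps], a point [s + k * eps >= t0] forces [k > -1]. *)
have : 0 < (k + 1)%:~R * eps by rewrite intrD mulrDl mul1r; lra.
by rewrite pmulr_lgt0// ltr0z ltzD1.
Qed.

Lemma grid_size_le (R : realType) (t0 tf eps s : R) :
  0 < eps -> t0 <= s <= tf ->
  (grid_size tf eps s <= grid_size tf eps t0)%N.
Proof.
move=> eps0 /andP[s0 s1].
have f0 : 0 <= Num.floor ((tf - s) / eps).
  by rewrite floor_ge0 divr_ge0 ?subr_ge0// ltW.
have : Num.floor ((tf - s) / eps) <= Num.floor ((tf - t0) / eps).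
  by apply: le_floor; rewrite ler_pM2r ?invr_gt0// lerD2l lerN2.
by rewrite /grid_size; lia.
Qed.

(** No class is longer than that of [t0]; the successor turns this bound into the strict one of the
    product over [n < N]. *)
Lemma grid_det_neq0 (R : realType) d (t0 tf eps s : R)
    (c : 'M[R[i]]_d * 'M[R[i]]_d * 'M[R[i]]_d) :
  0 < eps -> t0 <= s <= tf -> toeplitz_generic (grid_size tf eps t0).+1 c ->
  \det (toeplitz_mx (grid_size tf eps s) c) != 0.
Proof.
move=> eps0 s_itv; rewrite /toeplitz_generic /= /toeplitz_dets prodf_seq_neq0.
move=> /allP /(_ (Ordinal (_ : grid_size tf eps s < _)%N)) h.
by apply: (h (grid_size_le eps0 s_itv)); rewrite mem_index_enum.
Qed.

Lemma gridP (R : realType) (t0 tf eps t : R) :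
  0 < eps -> t \in `[t0, tf] ->
  exists2 s, (s \in `[t0, t0 + eps[) /\ s <= tf &
    exists k : 'I_(grid_size tf eps s), t = s + k%:~R * eps.
Proof.
move=> eps0 t_itv; have s_itv := grid_base_itv t0 t eps0.
have tE : t = grid_base t0 eps t + (grid_index t0 eps t)%:~R * eps by rewrite subrK.
have s_tf : grid_base t0 eps t <= tf.
  move: t_itv; rewrite in_itv/= => /andP[t_ge t_le].
  rewrite (le_trans _ t_le)// gerBl mulr_ge0 ?(ltW eps0)//.
  by rewrite ler0z floor_ge0 divr_ge0 ?subr_ge0// ltW.
exists (grid_base t0 eps t) => //.
have := in_grid eps0 s_itv s_tf (grid_index t0 eps t); rewrite -tE t_itv.
case: (grid_index t0 eps t) tE => // k tE /esym.
by rewrite le0z_nat ltz_nat => k_lt; exists (Ordinal k_lt).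
Qed.

(** * Unique solvability on the segment *)

Lemma box_surj (R : realType) d (t0 tf eps : R)
    (c : 'M[R[i]]_d * 'M[R[i]]_d * 'M[R[i]]_d) (g : R -> 'cV[R[i]]_d) :
  0 < eps -> toeplitz_generic (grid_size tf eps t0).+1 c ->
  exists u, {in `[t0, tf], box t0 tf eps c u =1 g}.
Proof.
move=> eps0 c_gen.
(* The condition on [s] is placed under the existential, so that a sequence exists for every real
   [s]; the zero sequence is the default. *)
have /choice [V VP] : forall s, exists v : nat -> 'cV[R[i]]_d, t0 <= s <= tf ->
    forall k : 'I_(grid_size tf eps s),
    col k (block_toeplitz c (\matrix_(i < d, j < grid_size tf eps s) v j i 0)) =
      g (s + k%:~R * eps).
  move=> s; have [s_itv|_] := boolP (t0 <= s <= tf); last by exists (fun=> 0).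
  have [v vP] := block_toeplitz_solve (fun k => g (s + k%:~R * eps))
    (grid_det_neq0 eps0 s_itv c_gen).
  by exists v.
(* The solutions on the classes are glued: [t] selects its class by [grid_base] and its place there
   by [grid_index]. *)
exists (fun t => V (grid_base t0 eps t) (absz (grid_index t0 eps t))) => t.
move=> /(gridP eps0) [s [s_itv s_tf] [k ->]].
rewrite (box_grid _ _ (in_grid eps0 s_itv s_tf)) -VP; last first.
  by rewrite s_tf andbT; move: s_itv; rewrite in_itv/= => /andP[].
congr (col _ (block_toeplitz _ _)); apply/matrixP => i j.
by rewrite !mxE grid_baseK// grid_indexK.
Qed.

(** On each class the values of [u] and [v] have the same image under a bijective operator. *)
Lemma box_inj (R : realType) d (t0 tf eps : R)
    (c : 'M[R[i]]_d * 'M[R[i]]_d * 'M[R[i]]_d) (u v : R -> 'cV[R[i]]_d) :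
  0 < eps -> toeplitz_generic (grid_size tf eps t0).+1 c ->
  {in `[t0, tf], box t0 tf eps c u =1 box t0 tf eps c v} -> {in `[t0, tf], u =1 v}.
Proof.
move=> eps0 c_gen uv _ /(gridP eps0) [s [s_itv s_tf] [k ->]].
have grid := in_grid eps0 s_itv s_tf.
have s_bd : t0 <= s <= tf.
  by rewrite s_tf andbT; move: s_itv; rewrite in_itv/= => /andP[].
have /bij_inj T_inj := block_toeplitz_bij (grid_det_neq0 eps0 s_bd c_gen).
pose M (w : R -> 'cV[R[i]]_d) := \matrix_(i < d, j < grid_size tf eps s) w (s + j%:~R * eps) i 0.
have /T_inj /matrixP UV : block_toeplitz c (M u) = block_toeplitz c (M v).
  apply/matrixP => i j.
  have : box t0 tf eps c u (s + j%:~R * eps) = box t0 tf eps c v (s + j%:~R * eps).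
    by apply: uv; rewrite grid le0z_nat ltz_nat ltn_ord.
  by rewrite !(box_grid _ _ grid) => /matrixP /(_ i 0); rewrite [LHS]mxE [RHS]mxE.
by apply/matrixP => i j; have := UV i k; rewrite ord1 !mxE.
Qed.

Theorem theorem5p2 (R : realType) (d : nat) (t0 tf eps : R)
    (hd : (1 <= d)%N) (ht : t0 <= tf) (heps : 0 < eps)
    (hM : (1 <= Num.floor ((tf - t0) / eps))%R) :
  exists Omega : set ('M[R[i]]_d * 'M[R[i]]_d * 'M[R[i]]_d),
    [/\ open Omega, dense Omega &
      forall c : 'M[R[i]]_d * 'M[R[i]]_d * 'M[R[i]]_d, Omega c ->
      forall g : `[t0, tf]%classic -> 'cV[R[i]]_d,
      exists! f : R -> 'cV[R[i]]_d,
        [/\ forall t : `[t0, tf]%classic, f (val t) = g t,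
            supp f `<=` `[t0 - eps, tf + eps]%classic &
            exists! w : `[t0, tf]%classic -> 'cV[R[i]]_d,
              solution_on eps c f w]].
Proof.
exists (toeplitz_generic (grid_size tf eps t0).+1); split.
- exact: open_toeplitz_generic.
- exact: dense_toeplitz_generic.
move=> c c_gen g.
pose G t := if insub t is Some t' then g t' else 0.
have [u uG] := box_surj G heps c_gen.
have val_itv (t : `[t0, tf]%classic) : val t \in `[t0, tf].
  exact: set_mem (valP t).
(* Any [v] whose image extends [g] is forced on the segment; uniqueness of the solution and of the
   extension both follow. *)
have uniq_u v : (forall t : `[t0, tf]%classic, box t0 tf eps c v (val t) = g t) ->
    {in `[t0, tf], v =1 u}.
  move=> vg; apply: (box_inj heps c_gen) => t t_itv.
  have t_set : t \in `[t0, tf]%classic by exact: mem_set.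
  by rewrite uG// /G insubT -vg.
exists (box t0 tf eps c u); split.
  split.
  - by move=> t; rewrite uG// /G valK.
  - exact/supp_box/ltW.
  exists (u \o val); split; first by exists u.
  move=> w [v [vw vf]]; apply/funext => t; rewrite -vw; apply/esym/uniq_u => //.
  by move=> s; rewrite vf uG// /G valK.
(* A competing [f] is [box v] for some [v]; as [f] extends [g], [v] agrees with [u] on the segment,
   and [box] sees only these values. *)
move=> f [fg _ [w [[v [_ vf]] _]]].
rewrite -(funext vf); apply: eq_box => t t_itv; apply/esym/uniq_u => // s.
by rewrite vf fg.
Qed.
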